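(* Let $(V,|0\rangle,T,Y,\mathcal{S})$ be a braided state-field correspondence. Suppose that for every $a,b,c\in V$ and $M\in\mathbb{Z}_{\ge0}$ there exists $N\ge0$ such that $$\iota_{z,w}\Big((z+w)^NY(z+w)(1\otimes Y(w))\mathcal{S}^{23}(w)\mathcal{S}^{13}(z+w)(a\otimes b\otimes c)\Big)=(z+w)^NY(w)\mathcal{S}(w)(Y(z)\otimes1)(a\otimes b\otimes c)\pmod{h^M}.$$ Then, for such $a,b,c,M,N$, $$\sum_{i,j}\partial_\sigma^N\,a^j_{(\sigma,g_j)}\big(b^i_{(-\lambda+\mu,h_i)}(c^j)^i\big)\Big|_{\sigma=\lambda}=(\partial_\lambda+\partial_\mu)^N\sum_r(a_\lambda b)^r_{(\mu,f_r)}c^r\pmod{h^M},$$ where $$\mathcal{S}(x)(a_\lambda b\otimes c)=\sum_rf_r(x)\,(a_\lambda b)^r\otimes c^r,$$ $$\mathcal{S}^{13}(x)(a\otimes b\otimes c)=\sum_jg_j(x)\,a^j\otimes b\otimes c^j,$$ $$\mathcal{S}^{23}(x)(a^j\otimes b\otimes c^j)=\sum_ih_i(x)\,a^j\otimes b^i\otimes(c^j)^i.$$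
   Context: $\mathbb{K}$ is a field of characteristic zero. A topologically free $\mathbb{K}[[h]]$-module is one isomorphic to $W[[h]]$ for a $\mathbb{K}$-vector space $W$; $U[[h]]\hat\otimes W[[h]]:=(U\otimes W)[[h]]$. $V_h((z))$ is the set of $a(z)\in V[[z,z^{-1}]]$ such that $a(z)\in V((z))$ modulo $h^M$ for every $M\ge0$. $\mathrm{Res}_z$ is the coefficient of $z^{-1}$. $\iota_{z,w}$ denotes expansion in the domain $|z|>|w|$ (nonnegative powers of $w$). A braided state-field correspondence $(V,|0\rangle,T,Y,\mathcal{S})$ consists of: a topologically free $\mathbb{K}[[h]]$-module $V$ with a nonzero vector $|0\rangle$ and a $\mathbb{K}[[h]]$-linear $T:V\to V$ with $T|0\rangle=0$; a $\mathbb{K}[[h]]$-linear map $Y:V\hat\otimes V\to V_h((z))$, written $Y(z)(a\otimes b)=Y(a,z)b=\sum_{n\in\mathbb{Z}}a_{(n)}b\,z^{-n-1}$, with $Y(z)(|0\rangle\otimes v)=v$, $Y(z)(v\otimes|0\rangle)\in v+V[[z]]z$ for all $v\in V$, and $\partial_zY(z)=TY(z)-Y(z)(1\otimes T)=Y(z)(T\otimes1)$; and a braiding, i.e. a $\mathbb{K}[[h]]$-linear map $\mathcal{S}(z):V\hat\otimes V\to V\hat\otimes V\hat\otimes(\mathbb{K}((z))[[h]])$ with $\mathcal{S}=1+O(h)$. $\mathcal{S}^{ij}$ denotes $\mathcal{S}$ acting in the $i$-th and $j$-th tensor factors (in this order), leaving the other factors unchanged. $Y$ and $\mathcal{S}$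 are extended linearly over the formal variables. For $f\in\mathbb{K}((z))[[h]]$ the $(\lambda,f)$-product is $a_{(\lambda,f)}b=\mathrm{Res}_z\,e^{\lambda z}f(z)Y(z)(a\otimes b)$, with values in $V\otimes\mathbb{K}[\lambda][[h]]$ ($h$-adically completed: polynomial in $\lambda$ with coefficients in $V$ modulo each $h^M$), and $a_\lambda b=a_{(\lambda,1)}b$. The decompositions of $\mathcal{S}$ have coefficients in $\mathbb{K}((x))[[h]]$ and are understood as $h$-adically convergent sums; the elements $b^i$, $(c^j)^i$ and the series $h_i$ may depend on $j$, and the terms $(a_\lambda b)^r\otimes c^r$ depend on $\lambda$ ($\mathcal{S}$ being extended linearly in $\lambda$), with $\partial_\lambda$ acting on all of that dependence. *)

(* Defs.v *)
From HB Require Import structures.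
From mathcomp Require Import all_boot all_order all_algebra.
From mathcomp Require Import boolp classical_sets functions cardinality fsbigop.
Set Implicit Arguments.
Unset Strict Implicit.
Unset Printing Implicit Defensive.
Import Order.TTheory GRing.Theory Num.Theory.
Local Open Scope classical_set_scope.
Local Open Scope ring_scope.
Local Open Scope quotient_scope.

Definition bilinear_map (K : fieldType) (U V X : lmodType K) (f : U -> V -> X) :=
  (forall v, linear (fun u => f u v)) /\ (forall u, linear (f u)).

(* The tensor product over K: formal sums of pairs (u, v), represented by
   sequences, two of them being identified when no bilinear map separates them.
   [tens_bilinear], [tliftE], [tlift_linear] and [tlift_uniq] below are the
   universal property. *)
Section TensorProduct.
Context {K : fieldType} (U V : lmodType K).

Definition fsum (X : lmodType K) (f : U -> V -> X) (s : seq (U * V)) : X :=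
  \sum_(p <- s) f p.1 p.2.

Definition tens_eq (s t : seq (U * V)) : bool :=
  `[< forall (X : lmodType K) (f : U -> V -> X),
        bilinear_map f -> fsum f s = fsum f t >].

Lemma tens_eq_equiv : equiv_class_of tens_eq.
Proof.
split=> [s|s t|t s u].
- exact/asboolP.
- by apply/asboolP/asboolP => H X f /H.
- move=> /asboolP H1 /asboolP H2; apply/asboolP => X f bf.
  by rewrite H1 // H2.
Qed.

Canonical tens_equiv := EquivRelPack tens_eq_equiv.

Definition tensor := {eq_quot tens_eq}.

HB.instance Definition _ := Choice.on tensor.
HB.instance Definition _ := EqQuotient.on tensor.

Definition tlift (X : lmodType K) (f : U -> V -> X) (t : tensor) : X :=
  fsum f (repr t).

Lemma tlift_pi (X : lmodType K) (f : U -> V -> X) s :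
  bilinear_map f -> tlift f (\pi_tensor s) = fsum f s.
Proof.
move=> bf; rewrite /tlift.
have /eqmodP/asboolP : repr (\pi_tensor s) = s %[mod tensor] by rewrite reprK.
exact.
Qed.

Lemma tens_pi_eq s t :
  (forall (X : lmodType K) (f : U -> V -> X), bilinear_map f ->
     fsum f s = fsum f t) -> \pi_tensor s = \pi_tensor t.
Proof. by move=> H; apply/eqmodP/asboolP. Qed.

Lemma tensor_eq (s t : tensor) :
  (forall (X : lmodType K) (f : U -> V -> X), bilinear_map f ->
     tlift f s = tlift f t) -> s = t.
Proof. by move=> H; rewrite -[s]reprK -[t]reprK; apply: tens_pi_eq. Qed.

Definition scale_seq (k : K) (s : seq (U * V)) := [seq (k *: p.1, p.2) | p <- s].

Lemma fsum_scale (X : lmodType K) (f : U -> V -> X) k s :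
  bilinear_map f -> fsum f (scale_seq k s) = k *: fsum f s.
Proof.
case=> lf _; rewrite /fsum big_map scaler_sumr; apply: eq_bigr => p _ /=.
have f0 : f 0 p.2 = 0.
  by have := lf p.2 (- 1) 0 0; rewrite scaler0 addr0 scaleN1r addNr.
by rewrite -[k *: p.1]addr0 lf f0 addr0.
Qed.

Lemma fsum_cat (X : lmodType K) (f : U -> V -> X) s t :
  fsum f (s ++ t) = fsum f s + fsum f t.
Proof. by rewrite /fsum big_cat. Qed.

Definition tzero : tensor := \pi_tensor [::].
Definition tadd (s t : tensor) : tensor := \pi_tensor (repr s ++ repr t).
Definition tscale (k : K) (t : tensor) : tensor :=
  \pi_tensor (scale_seq k (repr t)).
Definition topp : tensor -> tensor := tscale (- 1).

Lemma tlift_zero (X : lmodType K) (f : U -> V -> X) :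
  bilinear_map f -> tlift f tzero = 0.
Proof. by move=> bf; rewrite tlift_pi // /fsum big_nil. Qed.

Lemma tlift_add (X : lmodType K) (f : U -> V -> X) s t :
  bilinear_map f -> tlift f (tadd s t) = tlift f s + tlift f t.
Proof. by move=> bf; rewrite tlift_pi // fsum_cat. Qed.

Lemma tlift_scale (X : lmodType K) (f : U -> V -> X) k t :
  bilinear_map f -> tlift f (tscale k t) = k *: tlift f t.
Proof. by move=> bf; rewrite tlift_pi // fsum_scale. Qed.

Let tE := (tlift_add, tlift_scale, tlift_zero).

Lemma taddA : associative tadd.
Proof. by move=> x y z; apply: tensor_eq => X f bf; rewrite !tE ?addrA. Qed.
Lemma taddC : commutative tadd.
Proof. by move=> x y; apply: tensor_eq => X f bf; rewrite !tE // addrC. Qed.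
Lemma tadd0 : left_id tzero tadd.
Proof. by move=> x; apply: tensor_eq => X f bf; rewrite !tE // add0r. Qed.
Lemma taddN : left_inverse tzero topp tadd.
Proof.
by move=> x; apply: tensor_eq => X f bf; rewrite !tE // scaleN1r addNr.
Qed.

HB.instance Definition _ :=
  GRing.isZmodule.Build tensor taddA taddC tadd0 taddN.

Lemma tscaleA a b t : tscale a (tscale b t) = tscale (a * b) t.
Proof. by apply: tensor_eq => X f bf; rewrite !tE // scalerA. Qed.
Lemma tscale1 : left_id 1 tscale.
Proof. by move=> t; apply: tensor_eq => X f bf; rewrite !tE // scale1r. Qed.
Lemma tscaleDr : right_distributive tscale +%R.
Proof. by move=> k s t; apply: tensor_eq => X f bf; rewrite !tE // scalerDr. Qed.
Lemma tscaleDl t : {morph tscale^~ t : a b / a + b}.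
Proof. by move=> a b; apply: tensor_eq => X f bf; rewrite !tE // scalerDl. Qed.

HB.instance Definition _ :=
  GRing.Zmodule_isLmodule.Build K tensor tscaleA tscale1 tscaleDr tscaleDl.

Definition tens (u : U) (v : V) : tensor := \pi_tensor [:: (u, v)].

Lemma tliftE (X : lmodType K) (f : U -> V -> X) u v :
  bilinear_map f -> tlift f (tens u v) = f u v.
Proof. by move=> bf; rewrite tlift_pi // /fsum big_seq1. Qed.

Lemma tlift_linear (X : lmodType K) (f : U -> V -> X) :
  bilinear_map f -> linear (tlift f).
Proof. by move=> bf k s t; rewrite tlift_add // tlift_scale. Qed.

Lemma tens_bilinear : bilinear_map tens.
Proof.
split=> [v k u u'|u k v v']; apply: tensor_eq => X f bf;
  rewrite tlift_linear // !tliftE //; case: bf => fl fr; [exact: fl|exact: fr].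
Qed.

Lemma tens_gen (t : tensor) : exists s : seq (U * V),
  t = \sum_(p <- s) tens p.1 p.2.
Proof.
exists (repr t); apply: tensor_eq => X f bf.
rewrite {1}/tlift /fsum; elim: (repr t) => [|p s IHs].
  by rewrite !big_nil tlift_zero.
by rewrite !big_cons tlift_add // tliftE // IHs.
Qed.

Lemma tlift_uniq (X : lmodType K) (f : U -> V -> X) (F : tensor -> X) :
  bilinear_map f -> linear F -> (forall u v, F (tens u v) = f u v) ->
  F =1 tlift f.
Proof.
move=> bf lF Ff t; have [s ->] := tens_gen t.
have F0 : F 0 = 0.
  by have := lF (- 1) 0 0; rewrite scaler0 addr0 scaleN1r addNr.
elim: s => [|p s IHs]; first by rewrite !big_nil F0 tlift_zero.
rewrite !big_cons tlift_add // tliftE // -IHs -Ff.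
by rewrite -[in LHS](scale1r (tens _ _)) lF scale1r.
Qed.

End TensorProduct.

Arguments tensor {K} (U V)%_type.
Notation "U ⊗ V" := (tensor U V) (at level 40, left associativity) : type_scope.
Notation "u ⊗ v" := (tens u v) (at level 40, left associativity) : ring_scope.

(* The field K((z)), as a K-vector space; [f n] is the coefficient of z^n. *)
Section LaurentSeries.
Variable K : fieldType.

Definition is_laurent : {pred int -> K^o} :=
  fun f => `[< exists N : int, forall n, n < N -> f n = 0 >].

Lemma is_laurent_submod : submod_closed is_laurent.
Proof.
split=> [|k f g]; first by apply/asboolP; exists 0.
move=> /asboolP[N Nf] /asboolP[P Pg]; apply/asboolP; exists (Num.min N P) => n.
rewrite lt_min => /andP[nN nP].
by rewrite /GRing.add /= /GRing.scale /= Nf // Pg // addr0 scaler0.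
Qed.

HB.instance Definition _ :=
  GRing.isSubmodClosed.Build K (int -> K^o) is_laurent is_laurent_submod.

Record laurent := Laurent {
  laurent_coef :> int -> K^o; laurent_coefP : laurent_coef \in is_laurent }.

HB.instance Definition _ := [isSub for laurent_coef].
HB.instance Definition _ := [Choice of laurent by <:].
HB.instance Definition _ := [SubChoice_isSubLmodule of laurent by <:].

Lemma laurent_one_subproof :
  (fun n : int => (n == 0)%:R : K^o) \in is_laurent.
Proof.
by apply/asboolP; exists 0 => n; rewrite lt_neqAle => /andP[/negPf->].
Qed.

Definition laurent_one : laurent := Laurent laurent_one_subproof.

End LaurentSeries.

(* [hser X] is X[[h]]; [u d] is the coefficient of h^d.  The topologically free
   modules below are X[[h]] for X = W, W ⊗ W, ..., and the completed tensor
   product of U[[h]] and X[[h]] is hser (U ⊗ X). *)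
Notation hser X := (nat -> X) (only parsing).

Section TopologicallyFree.
Context {K : fieldType}.
Implicit Types U X Z : lmodType K.

Definition hscale X (f : hser K) (u : hser X) : hser X :=
  fun d => \sum_(k < d.+1) f k *: u (d - k)%N.

Definition hlinear U X (F : hser U -> hser X) :=
  (forall u v, F (u + v) = F u + F v) /\
  (forall f u, F (hscale f u) = hscale f (F u)).

Definition eqmodh (X : Type) (M : nat) (u v : hser X) :=
  forall d, (d < M)%N -> u d = v d.

Definition hmap (X X' : Type) (F : X -> X') (u : hser X) : hser X' :=
  fun d => F (u d).

Definition hconst X (x : X) : hser X := fun d => if d == 0%N then x else 0.

(* A K[[h]]-linear map F is h-adically continuous, so that it is the sum of the
   h^d F_d with F_d = hcoef F d linear over K, and F = hext (hcoef F). *)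
Definition hcoef U X (F : hser U -> hser X) (d : nat) : U -> X :=
  fun x => F (hconst x) d.

Definition hext U X (phi : nat -> U -> X) (u : hser U) : hser X :=
  fun d => \sum_(k < d.+1) phi (d - k)%N (u k).

Definition htens U X (u : hser U) (x : hser X) : hser (U ⊗ X) :=
  fun d => \sum_(k < d.+1) u k ⊗ x (d - k)%N.

Definition id_htens U X X' (F : hser X -> hser X') :
    hser (U ⊗ X) -> hser (U ⊗ X') :=
  hext (fun d => tlift (fun u x => u ⊗ hcoef F d x)).

Definition htens_id U X X' (F : hser X -> hser X') :
    hser (X ⊗ U) -> hser (X' ⊗ U) :=
  hext (fun d => tlift (fun x u => hcoef F d x ⊗ u)).

(* u ⊗ (x ⊗ z) |-> (u ⊗ x) ⊗ z *)
Definition tassoc U X Z : U ⊗ (X ⊗ Z) -> (U ⊗ X) ⊗ Z :=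
  tlift (fun u => tlift (fun x z => (u ⊗ x) ⊗ z)).

(* a ⊗ (b ⊗ c) |-> b ⊗ (a ⊗ c) *)
Definition tswap U X Z : U ⊗ (X ⊗ Z) -> X ⊗ (U ⊗ Z) :=
  tlift (fun u => tlift (fun x z => x ⊗ (u ⊗ z))).

(* coefficient of z^n on U ⊗ K((z)) *)
Definition lcoef U (n : int) : U ⊗ laurent K -> U :=
  tlift (fun u (f : laurent K) => f n *: u).

(* h-adically convergent families and their sums *)
Definition hsummable (I : choiceType) X (F : I -> hser X) :=
  forall M, finite_set [set i | ~ eqmodh M (F i) 0].

Definition hsum (I : choiceType) X (F : I -> hser X) : hser X :=
  fun d => \sum_(i \in [set: I]) F i d.

Definition has_hsum (I : choiceType) X (F : I -> hser X) (s : hser X) :=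
  hsummable F /\ s = hsum F.

End TopologicallyFree.

(* Formal distributions in z: [y n] is the coefficient of z^n.  An element of
   V[[z, z^-1]] for V = X[[h]] is written as hser (int -> X). *)
Section FormalDistributions.
Context {K : fieldType} {X : lmodType K}.

Definition laurent_modh (y : hser (int -> X)) :=
  forall M : nat, exists N : int,
    forall d n, (d < M)%N -> n < N -> y d n = 0.

Definition zderiv (y : int -> X) : int -> X :=
  fun n => (n + 1)%:~R *: y (n + 1).

Definition zpow (k : nat) (y : int -> X) : int -> X := fun n => y (n - k%:Z).

Definition Res (y : int -> X) : X := y (- 1).

Definition hlmul (f : hser (laurent K)) (y : hser (int -> X)) :
    hser (int -> X) :=
  fun d n => \sum_(e < d.+1) \sum_(m \in [set: int])
    f e m *: y (d - e)%N (n - m).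

Definition binz (n : int) (k : nat) : K :=
  (\prod_(i < k) (n - i%:Z)%:~R) / (k`!)%:R.

(* For P = \sum P n m x^n w^m, the expansion of P(z + w, w) in nonnegative powers
   of w, [p] and [q] being the exponents of z and w:
   x^(p+k) w^(q-k) contributes 'C(p+k, k) z^p w^q. *)
Definition iota_zw (P : int -> int -> X) : int -> int -> X :=
  fun p q => \sum_(k \in [set: nat])
    binz (p + k%:Z) k *: P (p + k%:Z) (q - k%:Z).

(* multiplication by z + w *)
Definition mul_zDw (Q : int -> int -> X) : int -> int -> X :=
  fun p q => Q (p - 1) q + Q p (q - 1).

End FormalDistributions.

(* Polynomials in \lambda: [u k] is the coefficient of \lambda^k; the h-adic
   completion of V[\lambda] consists of the u : hser (nat -> X) which are
   [poly_modh].  In several variables, the coefficients of the outer variable are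
   polynomials in the inner ones. *)
Section LambdaPolynomials.
Context {K : fieldType} {X : lmodType K}.

Definition poly_modh (u : hser (nat -> X)) :=
  forall M : nat, exists N : nat,
    forall d k, (d < M)%N -> (N <= k)%N -> u d k = 0.

Definition pderiv (u : nat -> X) : nat -> X := fun k => k.+1%:R *: u k.+1.

(* u(\nu) |-> u(- \lambda + \mu), as a polynomial in (\lambda, \mu) *)
Definition subst_lm (u : nat -> X) : nat -> nat -> X :=
  fun p q => ((- 1) ^+ p * 'C(p + q, p)%:R) *: u (p + q)%N.

(* u(\sigma, \lambda, \mu) |-> u(\lambda, \lambda, \mu) *)
Definition diag_sl (u : nat -> nat -> nat -> X) : nat -> nat -> X :=
  fun p q => \sum_(s < p.+1) u s (p - s)%N q.

End LambdaPolynomials.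

(* \partial_\lambda + \partial_\mu *)
Definition pderiv_lDm {K : fieldType} {X : lmodType K} (u : nat -> nat -> X) :
    nat -> nat -> X :=
  pderiv u + (fun p => pderiv (u p)).

(* Braided state-field correspondences on V = W[[h]]; [Y t d n] is the
   coefficient of h^d z^n in Y(z) t, so that a_(n) b has exponent - n - 1. *)
Record braided_sfc (K : fieldType) (W : lmodType K) := BraidedSFC {
  vac : hser W;
  opT : hser W -> hser W;
  Y : hser (W ⊗ W) -> hser (int -> W);
  S : hser (W ⊗ W) -> hser ((W ⊗ W) ⊗ laurent K);
  vac_neq0 : vac <> 0;
  opT_hlinear : hlinear opT;
  opT_vac : opT vac = 0;
  Y_hlinear : hlinear Y;
  Y_laurent : forall t, laurent_modh (Y t);
  Y_vacl : forall v : hser W,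
    Y (htens vac v) = (fun d n => if n == 0 then v d else 0);
  Y_vacr : forall (v : hser W) d,
    Y (htens v vac) d 0 = v d /\ (forall n, n < 0 -> Y (htens v vac) d n = 0);
  Y_transl : forall (t : hser (W ⊗ W)) (n : int),
    let Yn := fun t' d => Y t' d n in
    (fun d => zderiv (Y t d) n) = opT (Yn t) - Yn (id_htens opT t) /\
    opT (Yn t) - Yn (id_htens opT t) = Yn (htens_id opT t);
  S_hlinear : hlinear S;
  S_one : forall t, eqmodh 1 (S t) (fun d => t d ⊗ laurent_one K) }.

Section BraidedSFC.
Context {K : fieldType} {W : lmodType K} (B : braided_sfc W).

Definition Ycoef (n : int) (t : hser (W ⊗ W)) : hser W := fun d => Y B t d n.

Definition S23 (t : hser (W ⊗ (W ⊗ W))) : hser ((W ⊗ (W ⊗ W)) ⊗ laurent K) :=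
  hmap (@tassoc _ _ _ _) (id_htens (S B) t).

(* the action on the factors 2 and 3, conjugated by the flip of 1 and 2 *)
Definition S13 (t : hser (W ⊗ (W ⊗ W))) : hser ((W ⊗ (W ⊗ W)) ⊗ laurent K) :=
  hmap (tlift (fun u (f : laurent K) => tswap u ⊗ f))
    (S23 (hmap (@tswap _ _ _ _) t)).

Definition Scoef (n : int) (t : hser (W ⊗ W)) := hmap (lcoef n) (S B t).
Definition S23coef (n : int) (t : hser (W ⊗ (W ⊗ W))) := hmap (lcoef n) (S23 t).
Definition S13coef (n : int) (t : hser (W ⊗ (W ⊗ W))) := hmap (lcoef n) (S13 t).

(* Y(x) (1 ⊗ Y(w)) S^23(w) S^13(x) t, a formal distribution in (x, w) *)
Definition YYSS (t : hser (W ⊗ (W ⊗ W))) : hser (int -> int -> W) :=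
  fun d p q => \sum_(mn \in [set: int * int])
    Ycoef (p - mn.1) (id_htens (Ycoef (q - mn.2))
      (S23coef mn.2 (S13coef mn.1 t))) d.

(* Y(w) S(w) t *)
Definition YS (t : hser (W ⊗ W)) : hser (int -> W) :=
  fun d q => \sum_(n \in [set: int]) Ycoef (q - n) (Scoef n t) d.

(* Y(w) S(w) (Y(z) ⊗ 1) t, a formal distribution in (z, w) *)
Definition YSY (t : hser ((W ⊗ W) ⊗ W)) : hser (int -> int -> W) :=
  fun d p q => YS (htens_id (Ycoef p) t) d q.

Definition quasi_assoc (a b c : hser W) (M N : nat) :=
  eqmodh M
    (hmap (fun P => iota_zw (zpow N P)) (YYSS (htens a (htens b c))))
    (hmap (iter N mul_zDw) (YSY (htens (htens a b) c))).

(* a_(\lambda, f) b = Res_z e^(\lambda z) f(z) Y(z) (a ⊗ b) *)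
Definition lprod (f : hser (laurent K)) (a b : hser W) : hser (nat -> W) :=
  fun d k => (k`!)%:R^-1 *: Res (zpow k (hlmul f (Y B (htens a b)) d)).

(* a_(\lambda, 1) b *)
Definition lprod1 := lprod (hconst (laurent_one K)).

(* a_(\sigma, f) u(\lambda, \mu), as a polynomial in (\sigma, \lambda, \mu) *)
Definition lprodr (f : hser (laurent K)) (a : hser W)
    (u : hser (nat -> nat -> W)) : hser (nat -> nat -> nat -> W) :=
  fun d s p q => lprod f a (fun e => u e p q) d s.

(* u(\lambda)_(\mu, f) v(\lambda), as a polynomial in (\lambda, \mu) *)
Definition lprodl (f : hser (laurent K)) (u v : hser (nat -> W)) :
    hser (nat -> nat -> W) :=
  fun d p q => \sum_(k < p.+1)
    lprod f (fun e => u e k) (fun e => v e (p - k)%N) d q.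

(* S(x) (u(\lambda) ⊗ c), extended linearly in \lambda *)
Definition Slambda (u : hser (nat -> W)) (c : hser W) :
    hser (nat -> (W ⊗ W) ⊗ laurent K) :=
  fun d k => S B (htens (fun e => u e k) c) d.

End BraidedSFC.

(* f(x) (u(\lambda) ⊗ v(\lambda)) *)
Definition lterm (K : fieldType) (W : lmodType K) (f : hser (laurent K))
    (u v : hser (nat -> W)) : hser (nat -> (W ⊗ W) ⊗ laurent K) :=
  fun d k => \sum_(l < k.+1)
    htens (htens (fun e => u e l) (fun e => v e (k - l)%N)) f d.

(* Main.v *)
(* Multiply the quasi-associativity identity by e^(\lambda z + \mu w) and apply
   Res_z Res_w.  On the right, (z + w)^N acts on the exponential as
   (\partial_\lambda + \partial_\mu)^N.  On the left, the residue is invariant under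
   the substitution x = z + w, which turns the exponential into
   e^(\lambda x) e^((- \lambda + \mu) w) and (z + w)^N into x^N, that is, into
   \partial_\sigma^N on e^(\sigma x) at \sigma = \lambda.  The infinite sums are
   harmless since both sides are images of S(x)(a_\lambda b ⊗ c) and
   S^13(x)(a ⊗ b ⊗ c) under K[[h]]-linear, hence h-adically continuous, maps:
   (u ⊗ f) |-> coefficients of f(z) F(z) u, for a K[[h]]-linear F(z) with values
   in Laurent series modulo each power of h. *)
Require Import Defs.
From mathcomp Require Import all_boot all_order all_algebra.
From mathcomp Require Import boolp classical_sets functions cardinality fsbigop.
From mathcomp Require Import ring.
Set Implicit Arguments.
Unset Strict Implicit.
Unset Printing Implicit Defensive.
Import Order.TTheory GRing.Theory Num.Theory.
Local Open Scope ring_scope.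

(** * Additive maps and triple Cauchy products *)

Definition additive_map (X X' : zmodType) (L : X -> X') :=
  forall x y, L (x + y) = L x + L y.

Section AdditiveMaps.
Variables (X X' : zmodType) (L : X -> X').
Hypothesis addL : additive_map L.

Lemma additive_map0 : L 0 = 0.
Proof. by apply: (addrI (L 0)); rewrite -addL !addr0. Qed.

Lemma additive_map_sum (I : Type) (s : seq I) (P : pred I) (F : I -> X) :
  L (\sum_(i <- s | P i) F i) = \sum_(i <- s | P i) L (F i).
Proof. exact: (big_morph L addL additive_map0). Qed.

End AdditiveMaps.

Lemma linear_additive (K : fieldType) (U X : lmodType K) (L : U -> X) :
  linear L -> additive_map L.
Proof. by move=> lL x y; rewrite -[x in LHS]scale1r lL scale1r. Qed.

Lemma linear_scale (K : fieldType) (U X : lmodType K) (L : U -> X) :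
  linear L -> forall k x, L (k *: x) = k *: L x.
Proof.
move=> lL k x; rewrite -[k *: x]addr0 lL.
by rewrite (additive_map0 (linear_additive lL)) addr0.
Qed.

(** Both sides run over the triples of indices with total [d]; the induction splits off the triples
    whose last index is 0. *)
Lemma conv3_assoc (X : zmodType) (F : nat -> nat -> nat -> X) (d : nat) :
  \sum_(k < d.+1) \sum_(l < k.+1) F l (k - l)%N (d - k)%N =
  \sum_(l < d.+1) \sum_(k < (d - l).+1) F l k (d - l - k)%N.
Proof.
elim: d F => [|d IHd] F; first by rewrite !big_ord1.
rewrite big_ord_recr /= subnn.
rewrite (eq_bigr (fun k : 'I_d.+1 =>
  \sum_(l < k.+1) F l (k - l)%N (d - k).+1)); last first.
  by move=> k _; rewrite subSn // -ltnS.
rewrite (IHd (fun a b c => F a b c.+1)) -/(_ + _).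
rewrite [in RHS]big_ord_recr /= subnn big_ord1 subnn.
rewrite [X in _ + X = _]big_ord_recr /= subnn addrA; congr (_ + _).
rewrite -big_split; apply: eq_bigr => l _ /=.
have ld : (l <= d)%N by rewrite -ltnS.
rewrite (subSn ld) [in RHS]big_ord_recr /= subnn; congr (_ + _).
by apply: eq_bigr => k _; rewrite subSn // -ltnS.
Qed.

(** In the other bracketing of the triple sum, reversing the inner sum exchanges the first two
    indices. *)
Lemma conv3_swap (X : zmodType) (F : nat -> nat -> nat -> X) (d : nat) :
  \sum_(l < d.+1) \sum_(k < (d - l).+1) F l k (d - l - k)%N =
  \sum_(l < d.+1) \sum_(k < (d - l).+1) F k l (d - l - k)%N.
Proof.
rewrite -[RHS](conv3_assoc (fun a b c => F b a c)) -conv3_assoc.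
apply: eq_bigr => k _; rewrite (reindex_inj rev_ord_inj).
by apply: eq_bigr => l _; rewrite /= subSS subKn // -ltnS.
Qed.

(** * Finitely supported sums *)

Lemma finite_cofin (I : choiceType) (P : I -> Prop) :
  finite_set [set i | ~ P i] -> exists s : seq I, forall i, i \notin s -> P i.
Proof.
move=> /finite_seqP[s sE]; exists s => i si; apply: contrapT => Pi.
have : [set` s]%classic i by rewrite -sE.
exact/negP.
Qed.

Section FiniteSupport.
Context {I : choiceType} {X : zmodType}.
Implicit Types F G : I -> X.

Definition finsupp F := exists s : seq I, forall i, i \notin s -> F i = 0.

Lemma fsum_seq (s : seq I) F : uniq s -> (forall i, i \notin s -> F i = 0) ->
  \sum_(i \in [set: I]) F i = \sum_(i <- s) F i.
Proof.
move=> us Fs; rewrite (fsbigE s) //; last by move=> i _; apply: Fs.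
by apply: eq_bigl => i; rewrite in_setT.
Qed.

Lemma eq_fsum F G : F =1 G ->
  \sum_(i \in [set: I]) F i = \sum_(i \in [set: I]) G i.
Proof. by move=> /funext ->. Qed.

Lemma finsupp_uniq F : finsupp F ->
  exists2 s : seq I, uniq s & forall i, i \notin s -> F i = 0.
Proof.
move=> [s Fs]; exists (undup s); first exact: undup_uniq.
by move=> i; rewrite mem_undup; apply: Fs.
Qed.

Lemma fsumD F G : finsupp F -> finsupp G -> finsupp (fun i => F i + G i) /\
  \sum_(i \in [set: I]) (F i + G i) =
  \sum_(i \in [set: I]) F i + \sum_(i \in [set: I]) G i.
Proof.
move=> [s Fs] [t Gt]; pose r := undup (s ++ t).
have ir i : i \notin r -> i \notin s /\ i \notin t.
  by rewrite mem_undup mem_cat negb_or => /andP.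
have Fr i : i \notin r -> F i = 0 by case/ir => /Fs.
have Gr i : i \notin r -> G i = 0 by case/ir => _ /Gt.
have FGr i : i \notin r -> F i + G i = 0 by move=> ri; rewrite Fr ?Gr ?addr0.
split; first by exists r.
by rewrite !(fsum_seq (undup_uniq (s ++ t))) // big_split.
Qed.

Lemma fsum_sum (J : Type) (r : seq J) (F : J -> I -> X) :
  (forall j, finsupp (F j)) -> finsupp (fun i => \sum_(j <- r) F j i) /\
  \sum_(i \in [set: I]) \sum_(j <- r) F j i =
  \sum_(j <- r) \sum_(i \in [set: I]) F j i.
Proof.
move=> finF; elim: r => [|j r [IHs IHe]].
  split; first by exists [::] => i _; rewrite big_nil.
  by rewrite big_nil fsbig1 // => i _; rewrite big_nil.
have [H1 H2] := fsumD (finF j) IHs.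
have E : (fun i => \sum_(j0 <- j :: r) F j0 i) =1
         (fun i => F j i + \sum_(j0 <- r) F j0 i).
  by move=> i; rewrite big_cons.
split; last by rewrite (eq_fsum E) H2 IHe big_cons.
by case: H1 => s Hs; exists s => i /Hs; rewrite E.
Qed.

Lemma finsupp_eq F G : F =1 G -> finsupp F -> finsupp G.
Proof. by move=> /funext ->. Qed.

End FiniteSupport.

Lemma finsupp_forall (I J : eqType) (X : zmodType) (r : seq J) (F : J -> I -> X) :
  (forall j, exists s : seq I, forall i, i \notin s -> F j i = 0) ->
  exists s : seq I, forall i, i \notin s -> forall j, j \in r -> F j i = 0.
Proof.
move=> finF; elim: r => [|j r [s Fs]]; first by exists [::].
have [t Ft] := finF j; exists (s ++ t) => i; rewrite mem_cat negb_or.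
move=> /andP[si ti] k; rewrite inE => /orP[/eqP->|kr]; first exact: Ft.
exact: Fs.
Qed.

Lemma fsum_additive (I : choiceType) (X X' : zmodType) (L : X -> X')
    (F : I -> X) : additive_map L -> finsupp F ->
  finsupp (fun i => L (F i)) /\
  L (\sum_(i \in [set: I]) F i) = \sum_(i \in [set: I]) L (F i).
Proof.
move=> addL /finsupp_uniq[s us Fs].
have LFs i : i \notin s -> L (F i) = 0.
  by move=> /Fs ->; apply: additive_map0.
by split; [exists s|rewrite !(fsum_seq us) // additive_map_sum].
Qed.

(** The support is enlarged to the product of its two projections, where both sides are finite sums
    over a rectangle. *)
Lemma fsum_pair (I J : choiceType) (X : zmodType) (F : I * J -> X) :
  finsupp F -> \sum_(ij \in [set: I * J]) F ij =
    \sum_(i \in [set: I]) \sum_(j \in [set: J]) F (i, j).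
Proof.
case=> s Fs; pose s1 := undup [seq p.1 | p <- s].
pose s2 := undup [seq p.2 | p <- s].
have u1 : uniq s1 by apply: undup_uniq.
have u2 : uniq s2 by apply: undup_uniq.
have F1 i j : i \notin s1 -> F (i, j) = 0.
  rewrite mem_undup => is1; apply: Fs; apply: contra is1.
  exact: (map_f fst).
have F2 i j : j \notin s2 -> F (i, j) = 0.
  rewrite mem_undup => js2; apply: Fs; apply: contra js2.
  exact: (map_f snd).
rewrite (fsum_seq (s := [seq (i, j) | i <- s1, j <- s2])).
- rewrite big_allpairs (fsum_seq u1); last first.
    by move=> i si; apply: fsbig1 => j _; apply: F1.
  by apply: eq_bigr => i _; rewrite (fsum_seq u2) // => j; apply: F2.
- by apply: allpairs_uniq => // -[i j] [i' j'] _ _ [-> ->].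
- move=> [i j] ij; have [si|/F1->//] := boolP (i \in s1).
  have [sj|/F2->//] := boolP (j \in s2).
  by move: ij; rewrite allpairs_f.
Qed.

(** * K[[h]]-linear maps and h-adically convergent sums *)

Section HLinear.
Context {K : fieldType}.
Implicit Types U X Z : lmodType K.

(** The monomial h^n. *)
Definition hX (n : nat) : hser K := fun d => (d == n)%:R.

Lemma hscale_hX U (n : nat) (u : hser U) (d : nat) :
  hscale (hX n) u d = if (n <= d)%N then u (d - n)%N else 0.
Proof.
rewrite /hscale /hX; case: leqP => nd; last first.
  apply: big1 => k _; have /negPf-> : k != n :> nat.
    by apply: contraTneq nd => <-; rewrite -leqNgt -ltnS.
  by rewrite scale0r.
rewrite (bigD1 (Ordinal (nd : n < d.+1)%N)) //= eqxx scale1r big1 ?addr0 //.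
by move=> k /negPf kn; rewrite -val_eqE /= in kn; rewrite kn scale0r.
Qed.

Section OneMap.
Context {U X : lmodType K}.
Variable F : hser U -> hser X.
Hypothesis hlF : hlinear F.

Lemma hlinear_additive : additive_map F.
Proof. by case: hlF. Qed.

Lemma hlinear_coef_additive d : additive_map (fun u => F u d).
Proof. by move=> u v; rewrite hlinear_additive. Qed.

(* u = sum_(k <= d) h^k u_k + h^(d+1) (...) *)
Lemma hlinear_ext u d : F u d = hext (hcoef F) u d.
Proof.
have uE : u = \sum_(k < d.+1) hscale (hX k) (hconst (u k)) +
              hscale (hX d.+1) (fun e => u (e + d.+1)%N).
  apply/funext => e; rewrite fctE fct_sumE hscale_hX.
  under eq_bigr do rewrite hscale_hX.
  case: ltnP => de.
    rewrite subnK // big1 ?add0r // => k _.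
    rewrite /hconst subn_eq0; case: leqP => // _.
    by rewrite leqNgt (leq_trans (ltn_ord k) de).
  rewrite addr0 (bigD1 (Ordinal (de : e < d.+1)%N)) //= leqnn subnn /hconst eqxx.
  rewrite big1 ?addr0 // => k ke; rewrite subn_eq0.
  case: ifP => // ke'; case: ifP => // ek; case/eqP: ke; apply: val_inj => /=.
  by apply/eqP; rewrite eqn_leq ke' ek.
rewrite [in LHS]uE hlinear_additive (additive_map_sum hlinear_additive).
(* The tail is a multiple of h^(d+1), and so is its image, which thus vanishes in degree [d]. *)
rewrite !fctE fct_sumE [X in _ + X](_ : _ = 0); last first.
  by case: hlF => _ ->; rewrite hscale_hX ltnn.
rewrite addr0; apply: eq_bigr => k _.
case: hlF => _ ->; rewrite hscale_hX.
by have -> : (k <= d)%N by rewrite -ltnS.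
Qed.

Lemma hcoef_linear d : linear (hcoef F d).
Proof.
move=> k x y; rewrite /hcoef.
(* A scalar [k] acts as the constant series k h^0, so that linearity over K follows from linearity
   over K[[h]]. *)
have -> : hconst (k *: x + y) = hscale (fun e => k * hX 0 e) (hconst x) + hconst y.
  apply/funext => e; rewrite fctE.
  have -> : hscale (fun e => k * hX 0 e) (hconst x) e = k *: hscale (hX 0) (hconst x) e.
    by rewrite /hscale scaler_sumr; apply: eq_bigr => i _; rewrite scalerA.
  by rewrite hscale_hX subn0 /hconst; case: eqP => // _; rewrite scaler0 addr0.
rewrite hlinear_additive fctE; congr (_ + _).
case: hlF => _ ->.
transitivity (k *: hscale (hX 0) (F (hconst x)) d); last first.
  by rewrite hscale_hX subn0.
by rewrite /hscale scaler_sumr; apply: eq_bigr => i _; rewrite scalerA.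
Qed.

Lemma hlinear0 d : F 0 d = 0.
Proof. by rewrite (additive_map0 hlinear_additive). Qed.

(** This is h-adic continuity: by [hlinear_ext], degree [d] of the image involves only the degrees
    up to [d] of the argument. *)
Lemma eq_hlinear_mod u v d : (forall k, (k <= d)%N -> u k = v k) ->
  F u d = F v d.
Proof.
move=> uv; rewrite !hlinear_ext; apply: eq_bigr => k _.
by rewrite uv // -ltnS.
Qed.

End OneMap.

Lemma hext_hlinear U X (phi : nat -> U -> X) :
  (forall d, linear (phi d)) -> hlinear (hext phi).
Proof.
move=> lphi; split=> [u v|f u]; apply/funext => d.
  change (hext phi (u + v) d = hext phi u d + hext phi v d).
  rewrite /hext -big_split; apply: eq_bigr => k _ /=.
  exact: linear_additive.
rewrite /hext /hscale.
under eq_bigr do rewrite (additive_map_sum (linear_additive (lphi _))).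
rewrite (conv3_assoc (fun a b c => phi c (f a *: u b))).
apply: eq_bigr => l _; rewrite scaler_sumr; apply: eq_bigr => k _.
exact: linear_scale.
Qed.

Lemma hmap_hlinear U X (L : U -> X) : linear L -> hlinear (hmap L).
Proof.
move=> lL; split=> [u v|f u]; apply/funext => d; rewrite /hmap.
  exact: linear_additive.
rewrite /hscale (additive_map_sum (linear_additive lL)).
by apply: eq_bigr => k _; apply: linear_scale.
Qed.

Lemma comp_hlinear U X Z (F : hser X -> hser Z) (G : hser U -> hser X) :
  hlinear F -> hlinear G -> hlinear (fun u => F (G u)).
Proof.
by case=> addF scF [addG scG]; split=> *; rewrite ?addG ?addF ?scG ?scF.
Qed.

Lemma tens_additivel U X (x : X) : additive_map (fun u : U => u ⊗ x).
Proof. exact: linear_additive (proj1 (tens_bilinear U X) x). Qed.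

Lemma tens_additiver U X (u : U) : additive_map (fun x : X => u ⊗ x).
Proof. exact: linear_additive (proj2 (tens_bilinear U X) u). Qed.

Lemma htens_hlinearl U X (x : hser X) : hlinear (fun u : hser U => htens u x).
Proof.
apply: (hext_hlinear (phi := fun d u => u ⊗ x d)) => d.
exact: (proj1 (tens_bilinear U X) (x d)).
Qed.

Lemma htens_hlinearr U X (u : hser U) : hlinear (fun x : hser X => htens u x).
Proof.
rewrite (_ : (fun x => _) = hext (fun d x => u d ⊗ x)).
  by apply: hext_hlinear => d; exact: (proj2 (tens_bilinear U X) (u d)).
apply/funext => x; apply/funext => d; rewrite /htens /hext.
rewrite (reindex_inj rev_ord_inj); apply: eq_bigr => k _ /=.
by rewrite subSS subKn // -ltnS.
Qed.

Lemma tlift_linear2 U X Z (L : X -> Z) : linear L ->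
  bilinear_map (fun (u : U) (x : X) => u ⊗ L x).
Proof.
move=> lL; split=> [x|u]; first exact: (proj1 (tens_bilinear U Z) (L x)).
by move=> k x y; rewrite lL (proj2 (tens_bilinear _ _)).
Qed.

Lemma tlift_linear1 U X Z (L : X -> Z) : linear L ->
  bilinear_map (fun (x : X) (u : U) => L x ⊗ u).
Proof.
move=> lL; split=> [u|x]; last exact: (proj2 (tens_bilinear Z U) (L x)).
by move=> k x' y; rewrite lL (proj1 (tens_bilinear _ _)).
Qed.

Lemma id_htens_hlinear U X Z (F : hser X -> hser Z) : hlinear F ->
  hlinear (@id_htens _ U X Z F).
Proof.
move=> hlF; apply: hext_hlinear => d; apply/tlift_linear/tlift_linear2.
exact: hcoef_linear.
Qed.

Lemma id_htens_tens U X Z (F : hser X -> hser Z) (u : hser U) x : hlinear F ->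
  id_htens F (htens u x) = htens u (F x).
Proof.
move=> hlF; apply/funext => d; rewrite /id_htens /hext /htens.
have bF e := tlift_linear2 U (hcoef_linear hlF e).
under eq_bigr => k _.
  rewrite (additive_map_sum (linear_additive (tlift_linear (bF _)))).
  under eq_bigr do rewrite tliftE //.
  over.
rewrite (conv3_assoc (fun a b c => u a ⊗ hcoef F c (x b))).
apply: eq_bigr => l _; rewrite hlinear_ext //.
by rewrite (additive_map_sum (@tens_additiver _ _ _)).
Qed.

Lemma htens_id_tens U X Z (F : hser X -> hser Z) x (u : hser U) : hlinear F ->
  htens_id F (htens x u) = htens (F x) u.
Proof.
move=> hlF; apply/funext => d; rewrite /htens_id /hext.
have bF e := tlift_linear1 U (hcoef_linear hlF e).
under eq_bigr => k _.
  rewrite (additive_map_sum (linear_additive (tlift_linear (bF _)))).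
  under eq_bigr do rewrite tliftE //.
  over.
rewrite (conv3_assoc (fun a b c => hcoef F c (x a) ⊗ u b)).
rewrite /htens.
under [RHS]eq_bigr => k _.
  rewrite hlinear_ext // (additive_map_sum (@tens_additivel _ _ _)).
  over.
rewrite /= (conv3_assoc (fun a b c => hcoef F b (x a) ⊗ u c)).
(* The degree of [F] is the last index on the left and the middle one on the right, whence the
   reversal of the inner sum. *)
apply: eq_bigr => l _; rewrite (reindex_inj rev_ord_inj).
by apply: eq_bigr => k _; rewrite /= subSS subKn // -ltnS.
Qed.

(** Only finitely many members of the family are nonzero modulo h^(d+1), so degree [d] reduces to
    additivity on finite sums. Infinite decompositions of the braiding enter the proof through
    this. *)
Lemma hsum_hlinear (I : choiceType) U X (F : hser U -> hser X)
    (u : I -> hser U) s d : hlinear F -> has_hsum u s ->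
  finsupp (fun i => F (u i) d) /\ \sum_(i \in [set: I]) F (u i) d = F s d.
Proof.
move=> hlF [sumu ->].
have fu k : finsupp (fun i => u i k).
  have [r ru] := (finite_cofin (sumu k.+1)).
  by exists r => i /ru; apply.
have LE k := fsum_additive (linear_additive (hcoef_linear hlF (d - k))) (fu k).
have [fsF sF] := fsum_sum (index_enum 'I_d.+1) (fun k => proj1 (LE (nat_of_ord k))).
have E : (fun i => F (u i) d) =1 (fun i => \sum_(k < d.+1) hcoef F (d - k) (u i k)).
  by move=> i; rewrite hlinear_ext.
split; first exact: finsupp_eq (fsym E) fsF.
rewrite (eq_fsum E) sF hlinear_ext //; apply: eq_bigr => k _.
exact/esym/(proj2 (LE _)).
Qed.

End HLinear.

(** * Two-sided sequences bounded below *)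

Section LowerBounded.
Context {K : fieldType} {X : lmodType K}.
Implicit Types y : int -> X.

Definition lowb y := exists N : int, forall n, n < N -> y n = 0.

Lemma eq_lowb y y' : y =1 y' -> lowb y -> lowb y'.
Proof. by move=> /funext ->. Qed.

Lemma lowb_forall (J : eqType) (r : seq J) (y : J -> int -> X) :
  (forall j, lowb (y j)) ->
  exists N : int, forall j, j \in r -> forall n, n < N -> y j n = 0.
Proof.
move=> lby; elim: r => [|j r [N Nr]]; first by exists 0.
have [P Pj] := lby j; exists (Num.min N P) => i; rewrite inE => ir n.
rewrite lt_min => /andP[nN nP]; case/orP: ir => [/eqP->|ir]; first exact: Pj.
exact: Nr.
Qed.

Lemma lowb_sum (J : eqType) (r : seq J) (y : J -> int -> X) :
  (forall j, lowb (y j)) -> lowb (fun n => \sum_(j <- r) y j n).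
Proof.
move=> /(lowb_forall r)[N Nr]; exists N => n nN.
by rewrite big_seq big1 // => j jr; apply: Nr.
Qed.

Lemma int_interval_seq (a b : int) :
  exists s : seq int, forall m, a <= m -> m <= b -> m \in s.
Proof.
exists [seq a + k%:Z | k <- iota 0 `|b - a|.+1] => m am mb.
apply/mapP; exists `|m - a|%N.
  rewrite mem_iota add0n ltnS leq0n /= -lez_nat !abszE !ger0_norm ?subr_ge0 //.
    by rewrite lerD2r.
  exact: le_trans mb.
by rewrite abszE ger0_norm ?subr_ge0 // [RHS]addrC subrK.
Qed.

(** The bound for [f] restricts m from below, and the bound for [y] restricts m from above through q
    - m; a finite interval remains. *)
Lemma finsupp_conv (f : laurent K) y q : lowb y ->
  finsupp (fun m => f m *: y (q - m)).
Proof.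
case: f => f /= /asboolP[N Nf] [P Py].
have [s Ps] := int_interval_seq N (q - P); exists s => m ms.
have [mN|Nm] := ltP m N; first by rewrite Nf // scale0r.
have [mq|qm] := leP m (q - P); first by rewrite Ps in ms.
by rewrite Py ?scaler0 // ltrBlDl -ltrBlDr.
Qed.

End LowerBounded.

(** * Convolution with Laurent series over K *)

Lemma lcoef_bilinear (K : fieldType) (U : lmodType K) (m : int) :
  bilinear_map (fun (u : U) (f : laurent K) => f m *: u).
Proof.
split=> [f|u] k x y; first by rewrite scalerDr !scalerA mulrC.
rewrite (_ : (k *: x + y : laurent K) m = k * x m + y m) //.
by rewrite scalerDl scalerA.
Qed.

Lemma lcoef_linear (K : fieldType) (U : lmodType K) (m : int) :
  linear (@lcoef K U m).
Proof. exact/tlift_linear/lcoef_bilinear. Qed.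

Lemma lcoef_tens_sum (K : fieldType) (U : lmodType K) (m : int)
    (r : seq (U * laurent K)) :
  lcoef m (\sum_(p <- r) p.1 ⊗ p.2) = \sum_(p <- r) p.2 m *: p.1.
Proof.
rewrite (additive_map_sum (linear_additive (lcoef_linear _))).
by apply: eq_bigr => p _; rewrite /lcoef tliftE //; apply: lcoef_bilinear.
Qed.

Section Convolution.
Context {K : fieldType} {U X : lmodType K}.

(* coefficient of z^q in f(z) (sum_n z^n L_n(u)) *)
Definition conv (L : int -> U -> X) (q : int) : U ⊗ laurent K -> X :=
  tlift (fun u (f : laurent K) =>
    \sum_(m \in [set: int]) f m *: L (q - m) u).

Variable L : int -> U -> X.
Hypothesis linL : forall n, linear (L n).
Hypothesis lowL : forall u, lowb (fun n => L n u).

Lemma conv_bilinear q : bilinear_map (fun u (f : laurent K) =>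
  \sum_(m \in [set: int]) f m *: L (q - m) u).
Proof.
have fin u (f : laurent K) := finsupp_conv f q (lowL u).
have comb k u (f : laurent K) v (g : laurent K) :
    k *: \sum_(m \in [set: int]) f m *: L (q - m) u +
      \sum_(m \in [set: int]) g m *: L (q - m) v =
    \sum_(m \in [set: int]) (k *: (f m *: L (q - m) u) + g m *: L (q - m) v).
  have [finZ ->] := fsum_additive (scalerDr k) (fin u f).
  by have [_ ->] := fsumD finZ (fin v g).
split=> [f k u v|u k f g]; rewrite comb; apply: eq_fsum => m.
  by rewrite linL scalerDr !scalerA mulrC.
by rewrite (_ : (k *: f + g : laurent K) m = k * f m + g m) // scalerDl scalerA.
Qed.

Lemma conv_tens q u (f : laurent K) :
  conv L q (u ⊗ f) = \sum_(m \in [set: int]) f m *: L (q - m) u.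
Proof. exact/tliftE/conv_bilinear. Qed.

Lemma conv_linear q : linear (conv L q).
Proof. exact/tlift_linear/conv_bilinear. Qed.

(** In contrast to the definition on pure tensors, this form involves only the coefficients
    [lcoef m s], as do [YYSS] and [YS]. It follows by writing [s] as a finite sum of pure
    tensors. *)
Lemma convE q s : finsupp (fun m => L (q - m) (lcoef m s)) /\
  conv L q s = \sum_(m \in [set: int]) L (q - m) (lcoef m s).
Proof.
have [r ->] := tens_gen s.
have [fin sumE] := fsum_sum r (fun p => finsupp_conv p.2 q (lowL p.1)).
have E : (fun m => L (q - m) (lcoef m (\sum_(p <- r) p.1 ⊗ p.2))) =1
         (fun m => \sum_(p <- r) p.2 m *: L (q - m) p.1).
  move=> m; rewrite lcoef_tens_sum.
  rewrite (additive_map_sum (linear_additive (linL _))).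
  by apply: eq_bigr => p _; apply: linear_scale.
split; first exact: finsupp_eq (fsym E) fin.
rewrite (eq_fsum E) sumE (additive_map_sum (linear_additive (conv_linear _))).
by apply: eq_bigr => p _; apply: conv_tens.
Qed.

End Convolution.

(** * Convolution with Laurent series over K[[h]] *)

Section HConvolution.
Context {K : fieldType} {U X : lmodType K}.

(** [F] stands for the series F(z) with coefficients [F n], Laurent in z modulo each power of h; the
    lower bound may depend on the argument and on the degree. *)
Definition hlaurent (F : int -> hser U -> hser X) :=
  (forall n, hlinear (F n)) /\ forall u d, lowb (fun n => F n u d).

(** The K[[h]]-linear extension of u ⊗ f |-> coefficient of z^q in f(z) F(z) u. *)
Definition hconv (F : int -> hser U -> hser X) (q : int) :
    hser (U ⊗ laurent K) -> hser X :=
  hext (fun d => conv (fun n => hcoef (F n) d) q).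

Variable F : int -> hser U -> hser X.
Hypothesis lF : hlaurent F.

Let linF n d : linear (hcoef (F n) d).
Proof. by apply: hcoef_linear; case: lF. Qed.

Let lowF d u : lowb (fun n => hcoef (F n) d u).
Proof. by case: lF => _; apply. Qed.

Lemma hconv_hlinear q : hlinear (hconv F q).
Proof. by apply: hext_hlinear => d; apply: conv_linear. Qed.

Lemma hconvE q s d :
  finsupp (fun m => F (q - m) (hmap (lcoef m) s) d) /\
  hconv F q s d = \sum_(m \in [set: int]) F (q - m) (hmap (lcoef m) s) d.
Proof.
have cE (k : 'I_d.+1) := convE (fun n => linF n (d - k)) (lowF (d - k)) q (s k).
have [fin sumE] := fsum_sum (index_enum 'I_d.+1) (fun k => proj1 (cE k)).
have E : (fun m => F (q - m) (hmap (lcoef m) s) d) =1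
  (fun m => \sum_(k < d.+1) hcoef (F (q - m)) (d - k) (lcoef m (s k))).
  by move=> m; rewrite hlinear_ext //; case: lF.
split; first exact: finsupp_eq (fsym E) fin.
by rewrite (eq_fsum E) sumE; apply: eq_bigr => k _; rewrite (proj2 (cE k)).
Qed.

(** One finite set has to serve all degrees up to [d], since a further K[[h]]-linear map reads all
    of them ([eq_hlinear_mod]). *)
Lemma hconv_finsupp q s d : exists r : seq int, forall m, m \notin r ->
  forall k, (k <= d)%N -> F (q - m) (hmap (lcoef m) s) k = 0.
Proof.
elim: d => [|d [r Pr]].
  have [[r Pr] _] := hconvE q s 0; exists r => m mr k.
  by rewrite leqn0 => /eqP->; apply: Pr.
have [[r' Pr'] _] := hconvE q s d.+1; exists (r ++ r') => m.
rewrite mem_cat negb_or => /andP[mr mr'] k; rewrite leq_eqVlt => /orP[/eqP->|].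
  exact: Pr'.
by rewrite ltnS; apply: Pr.
Qed.

Lemma hconv_tens q u f d :
  hconv F q (htens u f) d = hlmul f (fun d n => F n u d) d q.
Proof.
have cvL e := conv_linear (fun n => linF n e) (lowF e) q.
have cvT e u0 f0 := conv_tens (fun n => linF n e) (lowF e) q u0 f0.
rewrite /hconv /hext /htens.
under eq_bigr => k _.
  rewrite (additive_map_sum (linear_additive (cvL _))).
  under eq_bigr do rewrite cvT.
  over.
pose G a b c := \sum_(m \in [set: int]) f b m *: hcoef (F (q - m)) c (u a).
(* The h-degree of [f] becomes the outer index, as in [hlmul]. *)
rewrite /= (conv3_assoc G) (conv3_swap G); apply: eq_bigr => e _.
have fin k := finsupp_conv (f e) q (lowF (d - e - k) (u k)).
have [_ <-] := fsum_sum (index_enum 'I_(d - e).+1) (fun k => fin (nat_of_ord k)).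
apply: eq_fsum => m; rewrite hlinear_ext; last by case: lF.
by rewrite /hext scaler_sumr.
Qed.

End HConvolution.

(** Each coefficient of the product is a finite sum by [finsupp_conv], so [L] passes under the
    multiplication by f(z). *)
Lemma hlmul_hlinear (K : fieldType) (X Z : lmodType K) (L : hser X -> hser Z)
    (f : hser (laurent K)) (y : hser (int -> X)) q d :
  hlinear L -> (forall d, lowb (y d)) ->
  L (fun d => hlmul f y d q) d =
  hlmul f (fun d n => L (fun e => y e n) d) d q.
Proof.
move=> hlL lowy; rewrite hlinear_ext // /hlmul /hext.
have fin e k := finsupp_conv (f e) q (lowy k).
have lL e := linear_additive (hcoef_linear hlL e).
transitivity (\sum_(k < d.+1) \sum_(e < k.+1) \sum_(m \in [set: int])
    f e m *: hcoef L (d - k) (y (k - e)%N (q - m))).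
  apply: eq_bigr => k _; rewrite (additive_map_sum (lL _)).
  apply: eq_bigr => e _; have [_ ->] := fsum_additive (lL (d - k)%N) (fin e (k - e)%N).
  by apply: eq_fsum => m; apply/linear_scale/hcoef_linear.
rewrite (conv3_assoc (fun a b c => \sum_(m \in [set: int])
  f a m *: hcoef L c (y b (q - m)))).
apply: eq_bigr => e _.
have lowL k : lowb (fun n => hcoef L (d - e - k) (y k n)).
  have [N yN] := lowy k; exists N => n /yN ->; exact: additive_map0.
have [_ <-] := fsum_sum (index_enum 'I_(d - e).+1)
  (fun k => finsupp_conv (f e) q (lowL (nat_of_ord k))).
by apply: eq_fsum => m; rewrite hlinear_ext // /hext scaler_sumr.
Qed.

(** * Iterated convolution *)

Section IteratedConvolution.
Context {K : fieldType}.
Implicit Types U X Z : lmodType K.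

Lemma hlaurent_mod U X (F : int -> hser U -> hser X) u d : hlaurent F ->
  exists N : int, forall n, n < N -> forall k, (k <= d)%N -> F n u k = 0.
Proof.
case=> _ /(_ u)/(lowb_forall (iota 0 d.+1))[N FN]; exists N => n nN k kd.
by apply: FN nN; rewrite mem_iota.
Qed.

Lemma hlaurent_compl U X Z (G : hser X -> hser Z) (F : int -> hser U -> hser X) :
  hlinear G -> hlaurent F -> hlaurent (fun n u => G (F n u)).
Proof.
move=> hlG lF; split=> [n|u d].
  by apply: comp_hlinear => //; case: lF.
have [N FN] := hlaurent_mod u d lF; exists N => n nN.
by rewrite (@eq_hlinear_mod _ _ _ _ hlG _ 0) ?hlinear0 // => k kd; apply: FN.
Qed.

Lemma hlaurent_compr U X Z (F : int -> hser X -> hser Z) (H : hser U -> hser X) :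
  hlaurent F -> hlinear H -> hlaurent (fun n u => F n (H u)).
Proof.
by case=> lF lowF lH; split=> [n|u d]; [apply: comp_hlinear|apply: lowF].
Qed.

Lemma hlaurent_id_htens U X Z (F : int -> hser X -> hser Z) :
  hlaurent F -> hlaurent (fun n => @id_htens K U X Z (F n)).
Proof.
move=> lF; have hlF n : hlinear (F n) by case: lF.
split=> [n|t d]; first exact: id_htens_hlinear.
apply: (lowb_sum (index_enum 'I_d.+1)) => k.
have [r ->] := tens_gen (t k).
have bF n := tlift_linear2 U (hcoef_linear (hlF n) (d - k)).
apply: eq_lowb (lowb_sum r (y := fun p n => p.1 ⊗ hcoef (F n) (d - k) p.2) _).
  move=> n; rewrite (additive_map_sum (linear_additive (tlift_linear (bF n)))).
  by apply: eq_bigr => p _; rewrite tliftE.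
move=> p; case: lF => _ /(_ (hconst p.2) (d - k)%N)[N FN]; exists N => n /FN.
by rewrite /hcoef => ->; apply: (additive_map0 (@tens_additiver _ _ _ _)).
Qed.

(** The exponents m that matter in degree [d] are controlled by [F] alone, hence lie in a finite set
    independent of p; what remains is a finite sum of families bounded below in p. *)
Lemma hlaurent_hconv U X Z (G : int -> hser X -> hser Z)
    (F : int -> hser U -> hser X) q :
  hlaurent G -> hlaurent F ->
  hlaurent (fun p => hconv (fun n u => G p (F n u)) q).
Proof.
move=> lG lF; have hlG p : hlinear (G p) by case: lG.
have lGF p := hlaurent_compl (hlG p) lF.
split=> [p|s d]; first exact: hconv_hlinear.
have [r Fr] := hconv_finsupp lF q s d.
apply: eq_lowb (lowb_sum (undup r)
  (y := fun m p => G p (F (q - m) (hmap (lcoef m) s)) d) _); last first.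
  by move=> m; case: lG.
move=> p; have [_ ->] := hconvE (lGF p) q s d.
rewrite (fsum_seq (undup_uniq r)) // => m; rewrite mem_undup => /Fr Fm.
by rewrite (@eq_hlinear_mod _ _ _ _ (hlG p) _ 0) ?hlinear0.
Qed.

(** This makes the sum over pairs in [YYSS] finite. The claim reduces to a pure tensor u ⊗ f. There
    the exponents n lie in a finite set that depends on u but not on m; for each such n, [f] bounds
    m below and [G] bounds m above. *)
Lemma finsupp_iterated_conv U X Z Z' (G : int -> hser X -> hser Z')
    (F : int -> hser Z -> hser X) (H : hser U -> hser (Z ⊗ laurent K)) p q s d :
  hlaurent G -> hlaurent F -> hlinear H ->
  finsupp (fun mn : int * int =>
    G (p - mn.1) (F (q - mn.2) (hmap (lcoef mn.2) (H (hmap (lcoef mn.1) s)))) d).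
Proof.
move=> lG lF hlH.
have hlG n : hlinear (G n) by case: lG.
have hlF n : hlinear (F n) by case: lF.
have hlL n : hlinear (fun u => F (q - n) (hmap (lcoef n) (H u))).
  apply: comp_hlinear => //; apply: comp_hlinear => //.
  exact/hmap_hlinear/lcoef_linear.
pose L m n u := G (p - m) (F (q - n) (hmap (lcoef n) (H u))).
have hlGL m n : hlinear (L m n) by apply: comp_hlinear.
have linL m n e := hcoef_linear (hlGL m n) e.
have fin0 e u (f : laurent K) :
    finsupp (fun mn : int * int => f mn.1 *: hcoef (L mn.1 mn.2) e u).
  have [r Fr] := hconv_finsupp lF q (H (hconst u)) e.
  have /(finsupp_forall r)[t Pt] n :
      finsupp (fun m => f m *: hcoef (L m n) e u).
    by apply: (@finsupp_conv _ _ f (fun m => G m _ e) p); case: lG.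
  exists [seq (m, n) | m <- t, n <- r] => -[m n] /= mn.
  have [nr|/Fr Fn] := boolP (n \in r); last first.
    rewrite /hcoef /L (@eq_hlinear_mod _ _ _ _ (hlG _) _ 0) ?hlinear0 //.
    exact: scaler0.
  have [mt|mt] := boolP (m \in t); last exact: Pt.
  by rewrite allpairs_f in mn.
have fin1 e s0 :
    finsupp (fun mn : int * int => hcoef (L mn.1 mn.2) e (lcoef mn.1 s0)).
  have [r ->] := tens_gen s0.
  have [fin _] := fsum_sum r (fun uf => fin0 e uf.1 uf.2).
  apply: finsupp_eq fin => mn; rewrite lcoef_tens_sum.
  rewrite (additive_map_sum (linear_additive (linL _ _ e))).
  by apply: eq_bigr => uf _; rewrite (linear_scale (linL _ _ e)).
have [fin _] := fsum_sum (index_enum 'I_d.+1)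
  (fun k => fin1 (d - nat_of_ord k)%N (s k)).
apply: finsupp_eq fin => mn.
by rewrite -[RHS]/(L mn.1 mn.2 _ _) (hlinear_ext (hlGL _ _)).
Qed.

End IteratedConvolution.

(** * Both sides of quasi-associativity as convolutions *)

Lemma trilinear_tlift (K : fieldType) (U X Z Z' : lmodType K)
    (g : U -> X -> Z -> Z') :
  (forall u, bilinear_map (g u)) -> (forall x z, linear (fun u => g u x z)) ->
  bilinear_map (fun u => tlift (g u)).
Proof.
move=> bg lg; split=> [t|u]; last exact: tlift_linear.
have addg u := linear_additive (tlift_linear (bg u)).
move=> k u v; have [r ->] := tens_gen t.
rewrite !(additive_map_sum (addg _)) scaler_sumr -big_split /=.
by apply: eq_bigr => p _; rewrite !tliftE // lg.
Qed.

Section Braided.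
Context {K : fieldType} {W : lmodType K} (B : braided_sfc W).

Lemma Ycoef_hlaurent : hlaurent (Ycoef B).
Proof.
split=> [n|t d].
  by case: (Y_hlinear B) => addY scY; split=> [u v|f u]; apply/funext => d;
    rewrite /Ycoef ?addY ?scY // /hscale fct_sumE.
by have [N YN] := Y_laurent B t d.+1; exists N => n nN; apply: YN.
Qed.

Let hlY n : hlinear (Ycoef B n). Proof. by case: Ycoef_hlaurent. Qed.

(* coefficient of x^p w^q in Y(x)(1 ⊗ Y(w)) T *)
Definition YYcoef p q (T : hser (W ⊗ (W ⊗ W))) :=
  Ycoef B p (id_htens (Ycoef B q) T).

Lemma YYcoef_tens p q a b c :
  YYcoef p q (htens a (htens b c)) = Ycoef B p (htens a (Ycoef B q (htens b c))).
Proof. by rewrite /YYcoef id_htens_tens. Qed.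

Lemma idY_hlaurent : hlaurent (fun n => @id_htens K W _ _ (Ycoef B n)).
Proof. exact: hlaurent_id_htens Ycoef_hlaurent. Qed.

Lemma YYcoef_hlaurent p : hlaurent (YYcoef p).
Proof. exact: hlaurent_compl idY_hlaurent. Qed.

Lemma tassoc_linear (U X Z : lmodType K) : linear (@tassoc K U X Z).
Proof.
apply/tlift_linear/trilinear_tlift => [u|x z].
  split=> [z|x]; first by move=> k x y; rewrite !(proj2 (tens_bilinear _ _))
    !(proj1 (tens_bilinear _ _)).
  exact: (proj2 (tens_bilinear _ _)).
by move=> k u v; rewrite !(proj1 (tens_bilinear _ _)).
Qed.

Lemma S23_hlinear : hlinear (S23 B).
Proof.
apply: comp_hlinear; first exact/hmap_hlinear/tassoc_linear.
exact/id_htens_hlinear/S_hlinear.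
Qed.

(** Coefficient of x^p w^q in Y(x)(1 ⊗ Y(w)) S^23(w) T. *)
Definition YYS p q (T : hser (W ⊗ (W ⊗ W))) := hconv (YYcoef p) q (S23 B T).

Lemma YYS_hlaurent q : hlaurent (fun p => YYS p q).
Proof.
exact: hlaurent_compr (hlaurent_hconv q Ycoef_hlaurent idY_hlaurent) S23_hlinear.
Qed.

(** By finiteness, the sum over pairs splits into an outer sum over the exponents of S^13(x) and an
    inner one over those of S^23(w). *)
Lemma YYSSE t d p q : YYSS B t d p q = hconv (fun p => YYS p q) p (S13 B t) d.
Proof.
rewrite /YYSS fsum_pair; last first.
  exact: finsupp_iterated_conv Ycoef_hlaurent idY_hlaurent S23_hlinear.
have [_ ->] := hconvE (YYS_hlaurent q) p (S13 B t) d.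
apply: eq_fsum => m; rewrite /YYS.
by have [_ ->] := hconvE (YYcoef_hlaurent (p - m)) q (S23 B (S13coef B m t)) d.
Qed.

Lemma YSE t d q : YS B t d q = hconv (Ycoef B) q (S B t) d.
Proof. by have [_ ->] := hconvE Ycoef_hlaurent q (S B t) d. Qed.

Lemma YSYE a b c d p q : YSY B (htens (htens a b) c) d p q =
  hconv (Ycoef B) q (S B (htens (Ycoef B p (htens a b)) c)) d.
Proof. by rewrite /YSY YSE htens_id_tens. Qed.

End Braided.

(** * Combinations and evaluations of K[[h]]-linear maps *)

Section HLinearCombinations.
Context {K : fieldType}.
Implicit Types U X Z : lmodType K.

Lemma hlinear_scale U X (F : hser U -> hser X) (k : K) (u : hser U) :
  hlinear F -> F (k *: u) = k *: F u.
Proof.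
move=> hlF.
apply/funext => d; change (F (k *: u) d = k *: F u d).
rewrite !(hlinear_ext hlF) /hext.
rewrite scaler_sumr; apply: eq_bigr => e _.
exact/linear_scale/hcoef_linear.
Qed.

Lemma hlinear_comb (J : Type) U X (r : seq J) (k : J -> K)
    (F : J -> hser U -> hser X) :
  (forall j, hlinear (F j)) ->
  hlinear (fun u d => \sum_(j <- r) k j *: F j u d).
Proof.
move=> hlF; split=> [u v|f u]; apply/funext => d.
  change (\sum_(j <- r) k j *: F j (u + v) d =
    \sum_(j <- r) k j *: F j u d + \sum_(j <- r) k j *: F j v d).
  rewrite -big_split /=; apply: eq_bigr => j _.
  by rewrite (hlinear_coef_additive (hlF j)) scalerDr.
rewrite [RHS]/hscale.
under [RHS]eq_bigr do rewrite scaler_sumr.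
rewrite exchange_big /=; apply: eq_bigr => j _.
case: (hlF j) => _ ->; rewrite scaler_sumr; apply: eq_bigr => e _.
by rewrite !scalerA mulrC.
Qed.

Lemma hlinear_fct (T : Type) U X (F : hser U -> hser (T -> X)) :
  (forall t, hlinear (fun u d => F u d t)) -> hlinear F.
Proof.
move=> hlF; split=> [u v|f u]; apply/funext => d; apply/funext => t.
  by have /(congr1 (fun w => w d)) := proj1 (hlF t) u v.
have /(congr1 (fun w => w d)) /= -> := proj2 (hlF t) f u.
by rewrite /hscale fct_sumE.
Qed.

Lemma hlinear_eval (T : Type) X (t : T) :
  hlinear (fun (u : hser (T -> X)) d => u d t).
Proof.
split=> [u v|f u]; apply/funext => d //.
by rewrite /hscale fct_sumE.
Qed.

Lemma eq_hsum (I : choiceType) X (F G : I -> hser X) :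
  F =1 G -> hsum F = hsum G.
Proof. by move=> /funext ->. Qed.

Lemma hsumE (I : choiceType) U X (F : hser U -> hser X) (u : I -> hser U) s :
  hlinear F -> has_hsum u s -> hsum (fun i => F (u i)) = F s.
Proof.
by move=> hlF us; apply/funext => d; have [_] := hsum_hlinear d hlF us.
Qed.

Lemma hlmul_one X (y : hser (int -> X)) :
  hlmul (hconst (laurent_one K)) y = y.
Proof.
apply/funext => d; apply/funext => n.
rewrite /hlmul big_ord_recl [X in _ + X]big1 ?addr0 => [|e _]; last first.
  by apply: fsbig1 => m _; rewrite /hconst /= scale0r.
rewrite subn0 (fsum_seq (s := [:: 0])) //.
  by rewrite big_seq1 /hconst /= scale1r subr0.
by move=> m; rewrite inE => /negPf m0; rewrite /hconst /= m0 scale0r.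
Qed.

End HLinearCombinations.

(** * Products in lambda as residues against exponentials *)

Section LambdaProducts.
Context {K : fieldType} {W : lmodType K} (B : braided_sfc W).
Hypothesis charK : [pchar K] =i pred0.

Lemma fact_neq0 n : (n`!)%:R != 0 :> K.
Proof. by move/pcharf0P: charK => ->; rewrite -lt0n fact_gt0. Qed.

Lemma factS_inv n : n.+1%:R / n.+1`!%:R = (n`!%:R)^-1 :> K.
Proof.
have := fact_neq0 n.+1; rewrite factS natrM mulf_eq0 negb_or => /andP[s0 fs0].
by rewrite invfM mulrA divff // mul1r.
Qed.

Lemma iter_pderiv (X : lmodType K) N (u : nat -> X) s :
  iter N pderiv u s = ((s + N)`!%:R / s`!%:R) *: u (s + N)%N.
Proof.
elim: N s => [|N IHN] s /=; first by rewrite addn0 divff ?fact_neq0 // scale1r.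
rewrite /pderiv IHN scalerA addSnnS; congr (_ *: _).
by rewrite mulrCA factS_inv.
Qed.

(** The hypothesis says that v is Res_z Res_w e^(\lambda z + \mu w) Q(z, w); each derivation brings
    down the factor z + w from the exponential. *)
Lemma iter_pderiv_lDm (X : lmodType K) N (Q : int -> int -> X)
    (v : nat -> nat -> X) :
  (forall p q : nat, v p q = (p`!%:R * q`!%:R)^-1 *: Q (- 1 - p%:Z) (- 1 - q%:Z)) ->
  forall p q : nat, iter N pderiv_lDm v p q =
    (p`!%:R * q`!%:R)^-1 *: iter N mul_zDw Q (- 1 - p%:Z) (- 1 - q%:Z).
Proof.
move=> vQ; elim: N => [|N IHN] p q //=.
have shift (n : nat) : (- 1 - n.+1%:Z : int) = - 1 - n%:Z - 1.
  by rewrite -addn1 PoszD opprD addrA.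
rewrite /pderiv_lDm /mul_zDw !fctE /pderiv fctE !IHN scalerDr !scalerA !shift.
congr (_ *: _ + _ *: _).
  by rewrite !invfM mulrA factS_inv.
by rewrite !invfM mulrCA factS_inv.
Qed.

(** Read backwards, the product has the factors i - p for i < k. The value vanishes for k > p, which
    makes the expansion finite at the exponent -1 - p of z. *)
Lemma binz_neg (p k : nat) :
  binz (- 1 - p%:Z + k%:Z) k = (- 1) ^+ k * 'C(p, k)%:R :> K.
Proof.
have ffactE j : \prod_(i < j) (p%:Z - i%:Z)%:~R = (p ^_ j)%:R :> K.
  elim: j => [|j IHj]; first by rewrite big_ord0.
  rewrite big_ord_recr /= IHj ffactnSr natrM.
  have [jp|pj] := leqP j p; first by rewrite subzn.
  by rewrite ffact_small // !mul0r.
rewrite /binz (reindex_inj rev_ord_inj) /=.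
rewrite (eq_bigr (fun i : 'I_k => (- 1) * (p%:Z - i%:Z)%:~R)) => [|i _].
  rewrite big_split /= prodr_const card_ord ffactE -bin_ffact natrM.
  by rewrite mulrA mulfK // fact_neq0.
rewrite mulN1r -rmorphN /= -subzn //; congr (_%:~R).
by rewrite -[i.+1]addn1 PoszD; ring.
Qed.

(** Invariance of the residue under x = z + w, in coefficients: Res_z Res_w z^p w^q P(z + w, w) =
    Res_x Res_w (x - w)^p w^q P(x, w). The index is s = p - k. *)
Lemma iota_zw_neg (X : lmodType K) (P : int -> int -> X) (p q : nat) :
  iota_zw P (- 1 - p%:Z) (- 1 - q%:Z) =
  \sum_(s < p.+1) ((- 1) ^+ (p - s) * 'C(p, s)%:R) *:
    P (- 1 - s%:Z) (- 1 - (p - s + q)%N%:Z).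
Proof.
rewrite /iota_zw (fsum_seq (iota_uniq 0 p.+1)); last first.
  move=> k; rewrite mem_iota /= add0n -leqNgt => pk.
  by rewrite binz_neg bin_small // mulr0 scale0r.
rewrite -[iota _ _]/(index_iota 0 p.+1) big_mkord (reindex_inj rev_ord_inj).
apply: eq_bigr => s _ /=; have sp : (s <= p)%N by rewrite -ltnS.
rewrite subSS binz_neg bin_sub //; congr (_ *: P _ _).
  by rewrite -subzn // addrA subrK.
by rewrite PoszD opprD [- _ - _]addrC addrA.
Qed.

Lemma lprodE f a b d k : lprod B f a b d k =
  (k`!%:R)^-1 *: hconv (Ycoef B) (- 1 - k%:Z) (htens (htens a b) f) d.
Proof. by rewrite (hconv_tens (Ycoef_hlaurent B)). Qed.

Lemma lprod1E a b d k :
  lprod1 B a b d k = (k`!%:R)^-1 *: Ycoef B (- 1 - k%:Z) (htens a b) d.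
Proof. by rewrite /lprod1 /lprod hlmul_one. Qed.

Lemma lprodlE f u v d p q : lprodl B f u v d p q = (q`!%:R)^-1 *:
  hconv (Ycoef B) (- 1 - q%:Z) (fun e => lterm f u v e p) d.
Proof.
have hlY := hconv_hlinear (Ycoef_hlaurent B) (- 1 - q%:Z).
rewrite /lprodl; under eq_bigr do rewrite lprodE.
rewrite -scaler_sumr; congr (_ *: _).
rewrite -(additive_map_sum (hlinear_coef_additive hlY d)).
by congr (hconv _ _ _ _); apply/funext => e; rewrite fct_sumE.
Qed.

Lemma lprodZr g a k w d s :
  lprod B g a (k *: w) d s = k *: lprod B g a w d s.
Proof.
have hlg : hlinear (fun x : hser W =>
    hconv (Ycoef B) (- 1 - s%:Z) (htens (htens a x) g)).
  apply: (comp_hlinear (hconv_hlinear (Ycoef_hlaurent B) _)).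
  exact: (comp_hlinear (htens_hlinearl _ g) (htens_hlinearr _ a)).
rewrite !lprodE (hlinear_scale _ _ hlg) -[(_ *: _) d]/(_ *: _ d) !scalerA.
by rewrite mulrC.
Qed.

(** For fixed [a], every coefficient of Y(x)(a ⊗ -) is K[[h]]-linear and so passes under the
    multiplication by h(w), by [hlmul_hlinear]. *)
Lemma lprod_nested g h a b c d s n :
  lprod B g a (fun e => lprod B h b c e n) d s = (s`!%:R * n`!%:R)^-1 *:
    hlmul g (fun d m => hconv (YYcoef B m) (- 1 - n%:Z)
      (htens (htens a (htens b c)) h) d) d (- 1 - s%:Z).
Proof.
have [hlY lowY] := Ycoef_hlaurent B.
pose w e := hlmul h (Y B (htens b c)) e (- 1 - n%:Z).
have -> : (fun e => lprod B h b c e n) = (n`!%:R)^-1 *: w by [].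
rewrite lprodZr lprodE scalerA invfM mulrC.
congr (_ *: _); rewrite (hconv_tens (Ycoef_hlaurent B)).
congr (hlmul _ _ _ _); apply/funext => e; apply/funext => m.
rewrite (hconv_tens (YYcoef_hlaurent B m)).
have hlm : hlinear (fun x : hser W => Ycoef B m (htens a x)).
  exact: (comp_hlinear (hlY m) (htens_hlinearr _ a)).
rewrite (hlmul_hlinear _ _ _ hlm); last by move=> k; apply: lowY.
congr (hlmul _ _ _ _); apply/funext => k; apply/funext => l.
by rewrite YYcoef_tens.
Qed.

(* coefficient of \lambda^p \mu^q x^s w^(p-s+q) in e^(\lambda (x - w) + \mu w) *)
Definition lmcoef (s p q : nat) : K :=
  (- 1) ^+ (p - s) * 'C(p, s)%:R / (p`!%:R * q`!%:R).

(** The derivative contributes (s+N)!/s!, the substitution (-1)^(p-s) 'C(p-s+q, p-s), and the two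
    exponentials 1/((s+N)! (p-s+q)!); the product is [lmcoef s p q]. *)
Lemma nested_lambdaE N g h a b c d p q :
  diag_sl (iter N pderiv
    (lprodr B g a (hmap subst_lm (lprod B h b c)) d)) p q =
  \sum_(s < p.+1) lmcoef s p q *:
    hlmul g (fun d m => hconv (YYcoef B m) (- 1 - (p - s + q)%N%:Z)
      (htens (htens a (htens b c)) h) d) d (- 1 - (s + N)%N%:Z).
Proof.
rewrite /diag_sl; apply: eq_bigr => s _; rewrite iter_pderiv.
(* Factorials are expanded through binomials so that [field] can cancel them; all factors are
   nonzero in characteristic zero. *)
have binp : p`! = ('C(p, s) * (s`! * (p - s)`!))%N by rewrite bin_fact // -ltnS.
set r := (p - s)%N in binp *.
have binr : (r + q)`! = ('C(r + q, r) * (r`! * q`!))%N.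
  by rewrite -{3}(addKn r q) bin_fact // leq_addr.
pose k : K := (- 1) ^+ r * 'C(r + q, r)%:R.
transitivity (((s + N)`!%:R / s`!%:R) *:
  lprod B g a (k *: (fun e => lprod B h b c e (r + q)%N)) d (s + N)%N) => //.
rewrite lprodZr lprod_nested !scalerA; congr (_ *: _).
have := fact_neq0 p; have := fact_neq0 (r + q); have := fact_neq0 (s + N).
rewrite /k /lmcoef -/r binp binr !natrM !mulf_eq0 !negb_or.
move=> sN0 /and3P[C1 r0 q0] /and3P[C2 s0 _].
by field; rewrite ?sN0 ?C1 ?C2 ?r0 ?q0 ?s0.
Qed.

End LambdaProducts.

(** * Comparison of the two residues *)

Theorem proposition7 (K : fieldType) (charK : [pchar K] =i pred0)
    (W : lmodType K) (B : braided_sfc W)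
    (assocB : forall (a b c : hser W) (M : nat),
       exists N : nat, quasi_assoc B a b c M N)
    (a b c : hser W) (M N : nat) (assocN : quasi_assoc B a b c M N)
    (R : choiceType) (f : R -> hser (laurent K)) (ab' c' : R -> hser (nat -> W))
    (poly_ab' : forall r, poly_modh (ab' r)) (poly_c' : forall r, poly_modh (c' r))
    (decS : has_hsum (fun r => lterm (f r) (ab' r) (c' r))
              (Slambda B (lprod1 B a b) c))
    (J : choiceType) (g : J -> hser (laurent K)) (aj cj : J -> hser W)
    (decS13 : has_hsum (fun j => htens (htens (aj j) (htens b (cj j))) (g j))
                (S13 B (htens a (htens b c))))
    (I : J -> choiceType) (h : forall j, I j -> hser (laurent K))
    (bi cji : forall j, I j -> hser W)
    (decS23 : forall j,
       has_hsum (fun i => htens (htens (aj j) (htens (bi j i) (cji j i))) (h j i))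
         (S23 B (htens (aj j) (htens b (cj j))))) :
  eqmodh M
    (hsum (fun j => hsum (fun i =>
       hmap (fun u => diag_sl (iter N pderiv u))
         (lprodr B (g j) (aj j)
            (hmap subst_lm (lprod B (h j i) (bi j i) (cji j i)))))))
    (hmap (iter N pderiv_lDm)
       (hsum (fun r => lprodl B (f r) (ab' r) (c' r)))).
Proof.
(* [Psi F] is Res_x Res_w x^N e^(\lambda (x - w) + \mu w) F(x, w), where [F p q] is the coefficient
   of x^p w^q; the shift by [N] is the factor x^N. *)
pose Psi (F : int -> int -> hser ((W ⊗ (W ⊗ W)) ⊗ laurent K) -> hser W)
    (u : hser ((W ⊗ (W ⊗ W)) ⊗ laurent K)) : hser (nat -> nat -> W) :=
  fun d p q => \sum_(s < p.+1) lmcoef s p q *: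
    F (- 1 - (s + N)%N%:Z) (- 1 - (p - s + q)%N%:Z) u d.
have Psi_hlinear F : (forall p q, hlinear (F p q)) -> hlinear (Psi F).
  by move=> hlF; apply: hlinear_fct => p; apply: hlinear_fct => q;
     apply: hlinear_comb.
(* [D] is meant for the output of S^13(x), before S^23(w) acts; [E j] below is meant for the output
   of S^23(w), with g_j(x) kept fixed. *)
pose D p q := hconv (fun m => YYS B m q) p.
have D_hlinear p q : hlinear (D p q).
  exact: hconv_hlinear (YYS_hlaurent B q) p.
pose E j p q := fun T => hconv (fun m => hconv (YYcoef B m) q) p (htens T (g j)).
have YYlaurent q := hlaurent_hconv q (Ycoef_hlaurent B) (idY_hlaurent B).
have E_hlinear j p q : hlinear (E j p q).
  exact: (comp_hlinear (hconv_hlinear (YYlaurent q) p) (htens_hlinearl _ (g j))).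
have LHS : hsum (fun j => hsum (fun i =>
       hmap (fun u => diag_sl (iter N pderiv u))
         (lprodr B (g j) (aj j)
            (hmap subst_lm (lprod B (h j i) (bi j i) (cji j i)))))) =
    Psi D (S13 B (htens a (htens b c))).
  (* The sum over j is the image of S^13(x)(a ⊗ b ⊗ c) under [Psi D]. For each fixed j, the sum over
     i is the image under [Psi (E j)] of the j-th S^23 term, so the second decomposition may depend
     on j. *)
  rewrite -(hsumE (Psi_hlinear D D_hlinear) decS13); apply: eq_hsum => j.
  transitivity (Psi (E j) (S23 B (htens (aj j) (htens b (cj j))))).
    rewrite -(hsumE (Psi_hlinear (E j) (E_hlinear j)) (decS23 j)).
    apply: eq_hsum => i; apply/funext => d; apply/funext => p; apply/funext => q.
    rewrite /hmap nested_lambdaE //; apply: eq_bigr => s _.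
    by rewrite /E (hconv_tens (YYlaurent _)).
  apply/funext => d; apply/funext => p; apply/funext => q.
  apply: eq_bigr => s _.
  by rewrite /E /D (hconv_tens (YYlaurent _)) (hconv_tens (YYS_hlaurent B _)).
(* [Phi] is Res_w e^(\mu w) Y(w) on each coefficient in \lambda; the one-term sum gives it the shape
   that [hlinear_comb] expects. *)
pose Phi (u : hser (nat -> (W ⊗ W) ⊗ laurent K)) : hser (nat -> nat -> W) :=
  fun d p q => \sum_(i < 1) (q`!%:R)^-1 *:
    hconv (Ycoef B) (- 1 - q%:Z) (fun e => u e p) d.
have Phi_hlinear : hlinear Phi.
  apply: hlinear_fct => p; apply: hlinear_fct => q; apply: hlinear_comb => _.
  exact: (comp_hlinear (hconv_hlinear (Ycoef_hlaurent B) _) (hlinear_eval _ p)).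
have RHS : hsum (fun r => lprodl B (f r) (ab' r) (c' r)) =
    Phi (Slambda B (lprod1 B a b) c).
  rewrite -(hsumE Phi_hlinear decS); apply: eq_hsum => r.
  apply/funext => d; apply/funext => p; apply/funext => q.
  by rewrite lprodlE // /Phi big_ord1.
rewrite LHS RHS => d dM; apply/funext => p; apply/funext => q.
rewrite /hmap (@iter_pderiv_lDm K charK W N (YSY B (htens (htens a b) c) d)).
  (* The residues see quasi-associativity only at these exponents, where [iota_zw_neg] makes the
     expansion a finite sum. *)
  have /(congr1 (fun P => P (- 1 - p%:Z) (- 1 - q%:Z))) := assocN d dM.
  rewrite /hmap => <-; rewrite iota_zw_neg // scaler_sumr; apply: eq_bigr => s _.
  rewrite scalerA mulrC; congr (_ *: _).
  by rewrite /D -YYSSE /zpow PoszD opprD addrA.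
move=> p' q'; rewrite /Phi big_ord1 YSYE invfM mulrC -scalerA; congr (_ *: _).
(* The factor 1/p'! of the coefficient of \lambda^p' in a_\lambda b passes through S(w) and Y(w) by
   linearity. *)
pose F u := hconv (Ycoef B) (- 1 - q'%:Z) (S B (htens u c)).
have hlF : hlinear F.
  apply: (comp_hlinear (hconv_hlinear (Ycoef_hlaurent B) _)).
  exact: (comp_hlinear (S_hlinear B) (htens_hlinearl _ c)).
transitivity (F ((p'`!%:R)^-1 *: Ycoef B (- 1 - p'%:Z) (htens a b)) d).
  congr (F _ d); apply/funext => e; exact: lprod1E.
by rewrite (hlinear_scale _ _ hlF).
Qed.
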